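(* Let $f_j(\Delta'_{n,k})$ denote the number of $j$-dimensional faces of the half-open hypersimplex $\Delta'_{n,k}$. Then, as formal power series, $$ \sum_{n\ge1}\sum_{k=1}^n\sum_{j=1}^n f_j(\Delta'_{n,k})\,x^k y^{n-k}t^j=\frac{(1-x)xt}{(1-x-y)(1-x-y-xt)(1-x-y-yt)}. $$
   Context: For integers $0<k\le n$, $\Delta_{n,k}=\{(x_1,\ldots,x_n)\in[0,1]^n : k-1\le x_1+\cdots+x_n\le k\}$ (a convex polytope) and the half-open hypersimplex is $\Delta'_{n,k}=\{(x_1,\ldots,x_n)\in[0,1]^n : k-1< x_1+\cdots+x_n\le k\}$. A $j$-face of $\Delta'_{n,k}$ is a set $F\cap\Delta'_{n,k}$ where $F$ is a $j$-dimensional face of $\Delta_{n,k}$ with $F\cap\Delta'_{n,k}\neq\emptyset$; $f_j(\Delta'_{n,k})$ is the number of such sets. *)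

(* Defs.v *)
From HB Require Import structures.
From mathcomp Require Import all_boot all_order all_algebra.
From mathcomp Require Import finmap.
From mathcomp Require Import boolp classical_sets functions cardinality reals.
Set Implicit Arguments. Unset Strict Implicit. Unset Printing Implicit Defensive.
Import Order.TTheory GRing.Theory Num.Theory.
Local Open Scope classical_set_scope.
Local Open Scope ring_scope.

Section Hypersimplex.
Variable R : realType.

Definition hypersimplex (n k : nat) : set 'rV[R]_n :=
  [set x | (forall i, 0 <= x 0 i <= 1) /\
           k%:R - 1 <= \sum_i x 0 i /\ \sum_i x 0 i <= k%:R].
Arguments hypersimplex : clear implicits.

Definition hhypersimplex (n k : nat) : set 'rV[R]_n :=
  [set x | (forall i, 0 <= x 0 i <= 1) /\
           k%:R - 1 < \sum_i x 0 i /\ \sum_i x 0 i <= k%:R].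
Arguments hhypersimplex : clear implicits.

(** F is a face of the convex polytope P: F = P cut by a (weakly) supporting
    hyperplane  <a,x> = b  with  <a,x> <= b  on P  (a = 0, b = 0 gives P itself). *)
Definition is_face (n : nat) (P F : set 'rV[R]_n) : Prop :=
  exists (a : 'rV[R]_n) (b : R),
    (forall x, P x -> \sum_i a 0 i * x 0 i <= b) /\
    F = [set x | P x /\ \sum_i a 0 i * x 0 i = b].

Definition aff_indep (n m : nat) (p : 'I_m.+1 -> 'rV[R]_n) : Prop :=
  \rank (\matrix_(i < m.+1) (p i - p ord0)) = m.

Definition has_dim (n : nat) (F : set 'rV[R]_n) (j : nat) : Prop :=
  (exists p : 'I_j.+1 -> 'rV[R]_n, (forall i, F (p i)) /\ aff_indep p) /\
  ~ (exists p : 'I_j.+2 -> 'rV[R]_n, (forall i, F (p i)) /\ aff_indep p).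

Definition hfaces (n k j : nat) : set (set 'rV[R]_n) :=
  [set G | exists F, is_face (hypersimplex n k) F /\ has_dim F j /\
           F `&` hhypersimplex n k !=set0 /\ G = F `&` hhypersimplex n k].
Arguments hfaces : clear implicits.

(** f_j(Delta'_{n,k}) : number of j-faces (this set is finite). *)
Definition fnum (n k j : nat) : nat := #|` fset_set (hfaces n k j)|.

End Hypersimplex.
Arguments fnum : clear implicits.

(** Formal power series in x, y, t with integer coefficients:
    s a b c = coefficient of x^a y^b t^c. *)
Definition fps3 := nat -> nat -> nat -> int.

Definition fps_add (F G : fps3) : fps3 := fun a b c => F a b c + G a b c.
Definition fps_sub (F G : fps3) : fps3 := fun a b c => F a b c - G a b c.
Definition fps_mul (F G : fps3) : fps3 := fun a b c =>
  \sum_(i < a.+1) \sum_(j < b.+1) \sum_(l < c.+1)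
     F i j l * G (a - i)%N (b - j)%N (c - l)%N.
Definition fps_one : fps3 := fun a b c => ((a == 0%N) && (b == 0%N) && (c == 0%N))%:R.
Definition fps_x : fps3 := fun a b c => ((a == 1%N) && (b == 0%N) && (c == 0%N))%:R.
Definition fps_y : fps3 := fun a b c => ((a == 0%N) && (b == 1%N) && (c == 0%N))%:R.
Definition fps_t : fps3 := fun a b c => ((a == 0%N) && (b == 0%N) && (c == 1%N))%:R.

Definition gf_den : fps3 :=
  let u := fps_sub (fps_sub fps_one fps_x) fps_y in
  fps_mul (fps_mul u (fps_sub u (fps_mul fps_x fps_t)))
          (fps_sub u (fps_mul fps_y fps_t)).
Definition gf_num : fps3 := fps_mul (fps_mul (fps_sub fps_one fps_x) fps_x) fps_t.

(** The series  sum_{n>=1} sum_{k=1}^n sum_{j=1}^n f_j(Delta'_{n,k}) x^k y^{n-k} t^j :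
    coefficient of x^a y^b t^c is f_c(Delta'_{a+b,a}) if 1 <= a and 1 <= c <= a+b
    (then n = a+b >= 1 and k = a <= n automatically), and 0 otherwise. *)
Definition face_gf (R : realType) : fps3 := fun a b c =>
  if (1 <= a)%N && (1 <= c)%N && (c <= a + b)%N
  then (fnum R (a + b) a c)%:R else 0.

(* Main.v *)
(** The relative interiors of the faces partition the polytope, so a face of positive
    dimension that meets the half-open hypersimplex is given by the set [S] of its
    coordinates frozen to 1, the set [E] of its free coordinates, and a flag [top]
    telling whether it lies in the hyperplane where the coordinate sum is [k].  Such
    data describe a [j]-face iff [#|E| = j + top] and [#|S| < k <= #|S| + j].

    With [u = 1 - x - y], the trinomial series [M_r], the sum over [a] and [b] of
    [(a+b+r)! / (a! b! r!) x^a y^b], satisfies [u M_(r+1) = M_r] and [u M_0 = 1].  So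
    the coefficient of [t^c] in the generating function is [h_c (M_c + y M_(c+1))] with
    [h_c = x y^(c-1) + ... + x^c]; multiplying by [u] turns it into
    [(1 - x) h_c M_c], and the two other factors of the denominator act on
    [h_c M_c] through the recurrence [h_(c+2) = (x + y) h_(c+1) - x y h_c]. *)
Require Import Defs.
From HB Require Import structures.
From mathcomp Require Import all_boot all_order all_algebra ring lra zify.
From mathcomp Require Import finmap.
From mathcomp Require Import boolp classical_sets functions cardinality reals.
Set Implicit Arguments. Unset Strict Implicit. Unset Printing Implicit Defensive.
Import Order.TTheory GRing.Theory Num.Theory.
Local Open Scope ring_scope.

(** * Formal power series *)

Definition pseries (R : Type) := nat -> R.

Section PowerSeries.
Variable R : comNzRingType.
Implicit Types (f g h : pseries R) (c : R).

HB.instance Definition _ := gen_eqMixin (pseries R).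
HB.instance Definition _ := gen_choiceMixin (pseries R).

Definition ps_zero : pseries R := fun=> 0.
Definition ps_opp f : pseries R := fun n => - f n.
Definition ps_add f g : pseries R := fun n => f n + g n.
Definition ps_const c : pseries R := fun n => if n is 0 then c else 0.
Definition ps_mul f g : pseries R := fun n => \sum_(i < n.+1) f i * g (n - i)%N.

Lemma ps_addA : associative ps_add.
Proof. by move=> f g h; apply/funext => n; rewrite /ps_add addrA. Qed.
Lemma ps_addC : commutative ps_add.
Proof. by move=> f g; apply/funext => n; rewrite /ps_add addrC. Qed.
Lemma ps_add0 : left_id ps_zero ps_add.
Proof. by move=> f; apply/funext => n; rewrite /ps_add add0r. Qed.
Lemma ps_addN : left_inverse ps_zero ps_opp ps_add.
Proof. by move=> f; apply/funext => n; rewrite /ps_add addNr. Qed.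

HB.instance Definition _ :=
  GRing.isZmodule.Build (pseries R) ps_addA ps_addC ps_add0 ps_addN.

(** Truncation transfers the ring axioms from polynomials: a coefficient of index below [n] in a
    product depends only on the truncations at [n], so commutativity and associativity are inherited
    from [{poly R}]. *)
Definition ps_trunc n f : {poly R} := \poly_(i < n) f i.

Lemma coef_ps_trunc_mul n f g m : (m < n)%N ->
  (ps_trunc n f * ps_trunc n g)`_m = ps_mul f g m.
Proof.
move=> mn; rewrite coefM; apply: eq_bigr => i _.
by rewrite !coef_poly (leq_ltn_trans (leq_ord i) mn) (leq_ltn_trans (leq_subr _ _) mn).
Qed.

Lemma ps_mulC : commutative ps_mul.
Proof.
move=> f g; apply/funext => n.
by rewrite -!(@coef_ps_trunc_mul n.+1) // mulrC.
Qed.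

Lemma ps_mulA : associative ps_mul.
Proof.
move=> f g h; apply/funext => n.
have assocl : ps_mul (ps_mul f g) h n =
    (ps_trunc n.+1 f * ps_trunc n.+1 g * ps_trunc n.+1 h)`_n.
  rewrite coefM; apply: eq_bigr => i _.
  by rewrite coef_ps_trunc_mul ?ltn_ord // coef_poly ltnS leq_subr.
rewrite assocl -mulrA coefM; apply: eq_bigr => i _.
by rewrite coef_ps_trunc_mul ?ltnS ?leq_subr // coef_poly ltn_ord.
Qed.

Lemma ps_mul_constl c f n : ps_mul (ps_const c) f n = c * f n.
Proof.
by rewrite /ps_mul big_ord_recl subn0 big1 ?addr0 // => i _; rewrite mul0r.
Qed.

Lemma ps_mul1 : left_id (ps_const 1) ps_mul.
Proof. by move=> f; apply/funext => n; rewrite ps_mul_constl mul1r. Qed.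

Lemma ps_mulDl : left_distributive ps_mul ps_add.
Proof.
move=> f g h; apply/funext => n; rewrite /ps_mul /ps_add -big_split /=.
by apply: eq_bigr => i _; rewrite mulrDl.
Qed.

Lemma ps_one_neq0 : ps_const 1 != 0.
Proof.
by apply/eqP => /(congr1 (fun f : pseries R => f 0%N)) /eqP; rewrite oner_eq0.
Qed.

HB.instance Definition _ := GRing.Zmodule_isComNzRing.Build (pseries R)
  ps_mulA ps_mulC ps_mul1 ps_mulDl ps_one_neq0.

Definition ps_X : pseries R := fun n => (n == 1)%:R.

Lemma psD f g n : (f + g) n = f n + g n. Proof. by []. Qed.
Lemma psN f n : (- f) n = - f n. Proof. by []. Qed.
Lemma psM f g n : (f * g) n = \sum_(i < n.+1) f i * g (n - i)%N.
Proof. by []. Qed.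
Lemma psCM c f n : (ps_const c * f) n = c * f n.
Proof. exact: ps_mul_constl. Qed.

Lemma ps_sum (I : Type) (r : seq I) (P : pred I) (F : I -> pseries R) n :
  (\sum_(i <- r | P i) F i) n = \sum_(i <- r | P i) F i n.
Proof. by elim/big_rec2: _ => // i x y _ <-. Qed.

Lemma psXM f n : (ps_X * f) n = if n is m.+1 then f m else 0.
Proof.
rewrite psM; case: n => [|n]; first by rewrite big_ord1 mul0r.
rewrite big_ord_recl mul0r add0r big_ord_recl /= subSS subn0 mul1r big1 ?addr0 //.
by move=> i _; rewrite mul0r.
Qed.

Lemma psXnM k f n : (ps_X ^+ k * f) n = if (k <= n)%N then f (n - k)%N else 0.
Proof.
elim: k n => [|k IH] n; first by rewrite mul1r subn0.
by rewrite exprS -mulrA psXM; case: n => // n; rewrite IH.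
Qed.

Lemma ps_constD c d : ps_const (c + d) = ps_const c + ps_const d.
Proof. by apply/funext => -[|n] //; rewrite psD addr0. Qed.

Lemma ps_constN c : ps_const (- c) = - ps_const c.
Proof. by apply/funext => -[|n] //; rewrite psN oppr0. Qed.

Lemma ps_constM c d : ps_const (c * d) = ps_const c * ps_const d.
Proof. by apply/funext => -[|n]; rewrite psCM ?mulr0. Qed.

Lemma ps_constX c k : ps_const (c ^+ k) = ps_const c ^+ k.
Proof. by elim: k => // k IH; rewrite !exprS ps_constM IH. Qed.

End PowerSeries.

(** * Series in two variables: trinomial series and homogeneous polynomials *)

Local Notation xyseries := (pseries (pseries int)).
Local Notation X := (ps_X (pseries int) : xyseries).
Local Notation Y := (ps_const (ps_X int) : xyseries).

Lemma xyM (f g : xyseries) a b :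
  (f * g) a b = \sum_(i < a.+1) \sum_(j < b.+1) f i j * g (a - i)%N (b - j)%N.
Proof. by rewrite psM ps_sum. Qed.

Lemma coef_monomialM k l (f : xyseries) a b : (X ^+ k * Y ^+ l * f) a b =
  if (k <= a)%N && (l <= b)%N then f (a - k)%N (b - l)%N else 0.
Proof.
rewrite -mulrA psXnM; case: leqP => //= _.
by rewrite -ps_constX psCM psXnM.
Qed.

(** This is the expansion of [(1 - X - Y) ^- r.+1]. Writing the trinomial coefficient as two
    binomials lets Pascal's rule act on each. *)
Definition trinom r : xyseries := fun a b => ('C(a + b + r, r) * 'C(a + b, a))%:R.

Lemma trinom0 : (1 - X - Y) * trinom 0 = 1.
Proof.
apply/funext => a; apply/funext => b.
rewrite !mulrBl mul1r !psD !psN psXM psCM /trinom.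
case: a => [|a]; case: b => [|b] /=; rewrite ?psD ?psN ?psXM /trinom;
  rewrite ?bin0 ?mul1n ?addn0 ?binn ?subr0 ?subrr //.
by rewrite !addSn !addnS !binS natrD; ring.
Qed.

(** Pascal's rule on the first binomial isolates the coefficient of [trinom r]; on the second, it
    splits the remainder into the two shifted terms, which cancel. *)
Lemma trinomS r : (1 - X - Y) * trinom r.+1 = trinom r.
Proof.
apply/funext => a; apply/funext => b.
rewrite !mulrBl mul1r !psD !psN psXM psCM /trinom.
case: a => [|a]; case: b => [|b] /=; rewrite ?psD ?psN ?psXM /trinom;
  rewrite ?bin0 ?addn0 ?add0n ?binn ?subr0 ?subrr ?muln1 ?addSn ?addnS.
- by [].
- by rewrite binS natrD; ring.
- by rewrite binS natrD; ring.
- rewrite (binS (a+b+r).+2 r) (binS (a+b).+1 a) !natrM !natrD.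
  by ring.
Qed.

(* The complete homogeneous polynomial of degree [c], minus its term [Y ^+ c]. *)
Definition hpoly c : xyseries := \sum_(i < c) X ^+ i.+1 * Y ^+ (c - i.+1).

Lemma hpolyS c : hpoly c.+1 = Y * hpoly c + X ^+ c.+1.
Proof.
rewrite /hpoly mulr_sumr big_ord_recr /= subnn expr0 mulr1; congr (_ + _).
by apply: eq_bigr => i _; rewrite subSn ?ltn_ord // (exprS Y) mulrCA.
Qed.

(** The characteristic polynomial is [(z - X)(z - Y)], as [(X - Y) * hpoly c = X * (X ^+ c - Y ^+
    c)] suggests. *)
Lemma hpoly_rec c : hpoly c.+2 - (X + Y) * hpoly c.+1 + X * Y * hpoly c = 0.
Proof. by rewrite !hpolyS !exprS; ring. Qed.

(* Reading [fps3] with [t] as the outermost variable. *)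
Definition tseries (F : fps3) : pseries xyseries := fun c a b => F a b c.

Lemma tseries_inj F G : tseries F = tseries G -> F = G.
Proof.
move=> FG; apply/funext => a; apply/funext => b; apply/funext => c.
by rewrite -[F a b c]/(tseries F c a b) FG.
Qed.

Lemma tseriesM F G : tseries (fps_mul F G) = tseries F * tseries G.
Proof.
apply/funext => c; apply/funext => a; apply/funext => b.
rewrite psM ps_sum ps_sum /tseries /fps_mul.
under [RHS]eq_bigr do rewrite xyM.
rewrite exchange_big /=; under eq_bigr do rewrite exchange_big /=.
rewrite exchange_big /=.
by under eq_bigr do rewrite exchange_big /=.
Qed.

Lemma tseriesB F G : tseries (fps_sub F G) = tseries F - tseries G.
Proof. by []. Qed.

Lemma tseries1 : tseries fps_one = 1.
Proof.
apply/funext => -[|c]; apply/funext => -[|a]; apply/funext => -[|b] //=.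
Qed.

Local Notation T := (ps_X xyseries : pseries xyseries).

Lemma tseries_x : tseries fps_x = ps_const X.
Proof.
apply/funext => -[|c]; apply/funext => -[|[|a]]; apply/funext => -[|b] //=.
Qed.

Lemma tseries_y : tseries fps_y = ps_const Y.
Proof.
apply/funext => -[|c]; apply/funext => -[|a]; apply/funext => -[|[|b]] //=.
Qed.

Lemma tseries_t : tseries fps_t = T.
Proof.
apply/funext => -[|[|c]]; apply/funext => -[|a]; apply/funext => -[|b] //=.
Qed.

Lemma face_series_identity (F : fps3) :
  (forall c, tseries F c = hpoly c * (trinom c + Y * trinom c.+1)) ->
  fps_mul F gf_den = gf_num.
Proof.
move=> FE; apply: tseries_inj.
rewrite /gf_den /gf_num !(tseriesM, tseriesB, tseries1, tseries_x, tseries_y, tseries_t).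
set Cx := ps_const X; set Cy := ps_const Y.
pose H : pseries xyseries := fun c => hpoly c * trinom c.
have -> : tseries F * ((1 - Cx - Cy) * (1 - Cx - Cy - Cx * T) * (1 - Cx - Cy - Cy * T)) =
  (1 - Cx - Cy) * tseries F * ((1 - Cx - Cy - Cx * T) * (1 - Cx - Cy - Cy * T)) by ring.
have Cu : 1 - Cx - Cy = ps_const (1 - X - Y) by rewrite !ps_constD !ps_constN.
(* By [trinomS], the factor [u] turns [trinom c + Y * trinom c.+1] into [(u + Y) * trinom c], and
   [u + Y = 1 - X]. *)
have -> : (1 - Cx - Cy) * tseries F = (1 - Cx) * H.
  rewrite Cu.
  have -> : 1 - Cx = ps_const (1 - X) by rewrite ps_constD ps_constN.
  apply/funext => c; rewrite !psCM FE.
  transitivity (hpoly c * ((1 - X - Y) * trinom c + Y * ((1 - X - Y) * trinom c.+1))).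
    by ring.
  by rewrite trinomS /H; ring.
rewrite -!mulrA; congr (_ * _).
set u := 1 - X - Y in Cu *.
(* Expanding in powers of [T] makes the coefficient of index [c] a combination of [H c], [H (c - 1)]
   and [H (c - 2)]. *)
transitivity (ps_const (u * u) * H - T * (ps_const (u * (X + Y)) * H)
   + T * (T * (ps_const (X * Y) * H))).
  by rewrite !ps_constM (ps_constD X Y) -/Cx -/Cy Cu; ring.
apply/funext => c; rewrite !psD psN psCM.
(* Index 0 gives 0, index 1 gives [X] and matches the numerator; from index 2 on, [trinom c] factors
   out and the recurrence gives 0. *)
case: c => [|[|c]]; rewrite !psXM ?psCM /H.
- by rewrite /hpoly big_ord0 mul0r !mulr0 subr0 addr0.
- rewrite /hpoly big_ord1 big_ord0 mul0r mulr0 subr0 addr0 mulr1.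
  transitivity (X * (u * (u * trinom 1))); first by rewrite expr1; ring.
  by rewrite trinomS trinom0 mulr1.
- transitivity ((hpoly c.+2 - (X + Y) * hpoly c.+1 + X * Y * hpoly c) * trinom c).
    transitivity (hpoly c.+2 * (u * (u * trinom c.+2)) -
        (X + Y) * hpoly c.+1 * (u * trinom c.+1) + X * Y * hpoly c * trinom c).
      by ring.
    by rewrite !trinomS; ring.
  by rewrite hpoly_rec mul0r mulr0.
Qed.

Local Open Scope classical_set_scope.

(** * Faces of polyhedra *)

Section Polyhedra.
Variable R : realType.

(** A point can move slightly in a direction that leaves its tight constraints unchanged. The
    minimum of finitely many positive bounds serves as step; adding 1 to the norm keeps the
    denominators positive. *)
Lemma small_step (I : finType) (p q : I -> R) :
  (forall i, 0 <= p i) -> (forall i, p i = 0 -> q i = 0) ->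
  exists2 e, 0 < e & forall i, 0 <= p i + e * q i.
Proof.
move=> p0 pq.
pose f i := if p i == 0 then 1 else p i / (1 + `|q i|).
exists (\big[Order.min/1]_i f i).
  apply: lt_bigmin => // i _; rewrite /f; case: eqP => // /eqP pi0.
  by rewrite divr_gt0 ?ltr_wpDr // lt_def pi0 p0.
move=> i; set e := \big[_/_]_i _.
have [pi0|pi0] := eqVneq (p i) 0; first by rewrite pi0 (pq i pi0) mulr0 addr0.
have ei : e <= p i / (1 + `|q i|).
  by have := @bigmin_le _ _ _ 1 i f; rewrite {2}/f (negPf pi0).
have e0 : 0 <= e.
  apply: le_bigmin => // j _; rewrite /f; case: eqP => // _.
  by rewrite divr_ge0 ?addr_ge0.
have : e * (1 + `|q i|) <= p i by rewrite -ler_pdivlMr // ltr_wpDr.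
have := ler_norm (- q i); rewrite normrN => qi.
have := ler_wpM2l e0 qi; lra.
Qed.

Variable n : nat.
Implicit Types (x y z v : 'rV[R]_n) (P F : set 'rV[R]_n).

(** This single combination covers the midpoints, prolonged segments and perturbed points used
    below. *)
Definition affine_form (l : 'rV[R]_n -> R) :=
  forall x y z e, l (x + e *: (y - z)) = l x + e * (l y - l z).

Lemma affine_dot (a : 'rV[R]_n) : affine_form (fun x => \sum_i a 0 i * x 0 i).
Proof.
move=> x y z e; rewrite -sumrB mulr_sumr -big_split /=.
by apply: eq_bigr => i _; rewrite !mxE; ring.
Qed.

Section Polyhedron.
Variables (I : finType) (l : I -> 'rV[R]_n -> R).
Hypothesis l_affine : forall c, affine_form (l c).
Local Notation P := [set x | forall c, 0 <= l c x].

(** Constraints are treated one at a time: if one is not tight on all of [F], the current point is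
    replaced by its midpoint with a point where it is slack. A midpoint is tight only where both
    ends are. *)
Lemma face_rel_interior F : is_face P F -> F !=set0 ->
  exists2 z, F z & forall c, l c z = 0 -> forall x, F x -> l c x = 0.
Proof.
move=> [a [b [ab FE]]] [x0 Fx0].
have Fge x c : F x -> 0 <= l c x by rewrite FE => -[+ _]; apply.
suff [z Fz zP] : exists2 z, F z & forall c, c \in enum I ->
    l c z = 0 -> forall x, F x -> l c x = 0.
  by exists z => // c; apply: zP; rewrite mem_enum.
elim: (enum I) => [|c s [z Fz IH]]; first by exists x0.
have [cF|/existsNP[w /not_implyP[Fw lw]]] := pselect (forall x, F x -> l c x = 0).
  by exists z => // d; rewrite in_cons => /orP[/eqP-> _|/IH].
have Fz' : F (z + 2^-1 *: (w - z)).
  move: (Fz) (Fw); rewrite FE => -[Pz az] [Pw aw]; split => [d|].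
    rewrite l_affine; have := Pz d; have := Pw d; lra.
  by rewrite affine_dot az aw; ring.
exists (z + 2^-1 *: (w - z)) => // d; rewrite in_cons l_affine.
have lwd := Fge _ d Fw; have lzd := Fge _ d Fz.
case/orP => [/eqP dc|/IH zd] l0.
  by case: lw; rewrite -dc; lra.
by apply: zd; lra.
Qed.

(* The face is determined by [z]: for [x] in [P] tight where [z] is, the segment
   from [x] to [z] can be prolonged beyond [z] within [P], so the supporting
   functional, maximal at [z], is also maximal at [x]. *)
Lemma face_eq_tight F z : is_face P F -> F z ->
  (forall c, l c z = 0 -> forall x, F x -> l c x = 0) ->
  F = [set x | P x /\ forall c, l c z = 0 -> l c x = 0].
Proof.
move=> [a [b [ab FE]]] Fz zF; apply/seteqP; split => x /=.
  by move=> Fx; split => [|c /zF]; [move: Fx; rewrite FE => -[]|apply].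
move=> [Px xz]; move: (Fz); rewrite FE => -[Pz az]; split => //.
have [||e e0 He] := @small_step I (l^~ z) (fun c => l c z - l c x).
- by [].
- by move=> c lz; rewrite lz xz // subrr.
have : P (z + e *: (z - x)) by move=> c; rewrite l_affine.
move=> /ab; rewrite (affine_dot a) az; have := ab x Px.
set d := \sum_i _ => db h; apply/eqP; rewrite eq_le db /=.
have : e * (b - d) <= 0 by lra.
by rewrite pmulr_rle0 // subr_le0.
Qed.

End Polyhedron.

(** [V] plays the direction space of [F] and [z] a relative interior point: differences of points of
    [F] stay in [V], and conversely any [m] directions of [V], scaled by a common factor, can be
    followed from [z] inside [F]. *)
Lemma aff_indep_rank m F (q : nat) (V : 'M[R]_(q, n)) z :
  F z -> (forall x y, F x -> F y -> (x - y <= V)%MS) ->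
  (forall B : 'M[R]_(m, n), (B <= V)%MS ->
     exists2 e, 0 < e & forall i, F (z + e *: row i B)) ->
  (exists p : 'I_m.+1 -> 'rV[R]_n, (forall i, F (p i)) /\ aff_indep p) <->
  (m <= \rank V)%N.
Proof.
move=> Fz FV step; split.
  move=> [p [Fp <-]]; apply: mxrankS; apply/row_subP => i.
  by rewrite rowK; apply: FV.
move=> mV.
(* The first [m] vectors of a basis of [V]. *)
pose B : 'M[R]_(m, n) := pid_mx m *m row_base V.
have BV : (B <= V)%MS by rewrite (submx_trans (submxMl _ _)) ?eq_row_base.
have rB : \rank B = m by rewrite mxrankMfree ?row_base_free // rank_pid_mx.
have [e e0 He] := step B BV.
pose p (i : 'I_m.+1) := if unlift ord0 i is Some j then z + e *: row j B else z.
exists p; split=> [i|]; first by rewrite /p; case: unliftP.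
rewrite /aff_indep -[RHS]rB -(mxrank_scale_nz B (lt0r_neq0 e0)).
have p0 : p ord0 = z by rewrite /p unlift_none.
apply/eqmx_rank/andP; split; apply/row_subP => i.
  rewrite rowK p0 /p; case: unliftP => [j _|_].
    by rewrite addrAC subrr add0r -linearZ row_sub.
  by rewrite subrr sub0mx.
have -> : row i (e *: B) = row (lift ord0 i) (\matrix_(i < m.+1) (p i - p ord0)).
  by rewrite rowK p0 /p liftK addrAC subrr add0r linearZ.
exact: row_sub.
Qed.

End Polyhedra.

(** * Direction spaces of the faces *)

Section CoordinateSpace.
Variables (R : realType) (n : nat) (E : {set 'I_n}) (top : bool).

Definition coord_mx : 'M[R]_(#|E|, n) := \matrix_(i, j) (enum_val i == j)%:R.

(** The kernel of the all-ones column imposes a zero coordinate sum; the zero column imposes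
    nothing. [coord_mx] then places the coordinates at the positions in [E]. *)
Definition coord_space : 'M[R]_(#|E|, n) :=
  kermx (if top then const_mx 1 else 0 : 'cV[R]_#|E|) *m coord_mx.

Lemma mul_row_coord_mx (w : 'rV[R]_#|E|) i :
  (w *m coord_mx) 0 (enum_val i) = w 0 i.
Proof.
rewrite mxE (bigD1 i) //= mxE eqxx mulr1 big1 ?addr0 // => j ji.
by rewrite mxE (inj_eq enum_val_inj) (negPf ji) mulr0.
Qed.

Lemma mul_row_coord_mx0 (w : 'rV[R]_#|E|) j : j \notin E ->
  (w *m coord_mx) 0 j = 0.
Proof.
move=> jE; rewrite mxE big1 // => i _; rewrite mxE.
by case: eqP => [ij|]; rewrite ?mulr0 //; rewrite -ij enum_valP in jE.
Qed.

Lemma sum_coord (v : 'rV[R]_n) : (forall i, i \notin E -> v 0 i = 0) ->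
  \sum_i v 0 i = \sum_(i < #|E|) v 0 (enum_val i).
Proof.
move=> vE; rewrite (bigID (mem E)) /= [X in _ + X]big1 // addr0.
by rewrite big_enum_val.
Qed.

Lemma coord_spaceP (v : 'rV[R]_n) : (v <= coord_space)%MS <->
  (forall i, i \notin E -> v 0 i = 0) /\ (top -> \sum_i v 0 i = 0).
Proof.
split.
  move=> /submxP[D ->]; rewrite /coord_space mulmxA.
  set w := D *m _; have h j := @mul_row_coord_mx0 w j; split => // tp.
  rewrite sum_coord //; under eq_bigr do rewrite mul_row_coord_mx.
  have : w *m const_mx 1 = 0 :> 'cV[R]_1 by rewrite /w tp -mulmxA mulmx_ker mulmx0.
  move=> /matrixP/(_ 0 0); rewrite !mxE => {2}<-.
  by apply: eq_bigr => i _; rewrite [const_mx _ _ _]mxE mulr1.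
move=> [vE vtop]; pose w : 'rV[R]_#|E| := \row_i v 0 (enum_val i).
have -> : v = w *m coord_mx.
  apply/rowP => j; have [jE|jE] := boolP (j \in E); last first.
    by rewrite mul_row_coord_mx0 ?vE.
  by rewrite -(enum_rankK_in jE jE) mul_row_coord_mx mxE.
apply: submxMr; apply/sub_kermxP; case: top vtop => [/(_ isT) v0|_]; last exact: mulmx0.
apply/rowP => j; rewrite !mxE -[RHS]v0 sum_coord //.
by apply: eq_bigr => i _; rewrite !mxE mulr1.
Qed.

Lemma rank_coord_space : \rank coord_space = (#|E| - top)%N.
Proof.
have free : row_free coord_mx.
  apply/row_freeP; exists coord_mx^T; apply/matrixP => i j.
  rewrite !mxE (bigD1 (enum_val j)) //= !mxE eqxx mulr1 big1 ?addr0.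
    by rewrite (inj_eq enum_val_inj).
  by move=> k kj; rewrite !mxE [enum_val j == _]eq_sym (negPf kj) mulr0.
rewrite mxrankMfree // mxrank_ker; case: top; last by rewrite mxrank0.
(* For empty [E] the all-ones column has rank 0, but truncated subtraction still gives the right
   value. *)
have [E0|[i iE]] := set_0Vmem E; first by rewrite E0 cards0 !sub0n.
congr subn; apply/eqP; rewrite eqn_leq rank_leq_col lt0n mxrank_eq0.
apply/eqP => /matrixP/(_ (enum_rank_in iE i) 0).
by rewrite !mxE => /eqP; rewrite oner_eq0.
Qed.

End CoordinateSpace.

(** * Faces of hypersimplices *)

Section HypersimplexFaces.
Variables (R : realType) (n k : nat).
Implicit Types (x y z : 'rV[R]_n) (E S : {set 'I_n}) (top : bool).
Local Notation P := (@hypersimplex R n k).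

(** All the inequalities form one finite family of affine forms, as the lemmas on polyhedra
    require. *)
Definition slack (c : 'I_n + 'I_n + bool) x : R :=
  match c with
  | inl (inl i) => x 0 i
  | inl (inr i) => 1 - x 0 i
  | inr true => k%:R - \sum_i x 0 i
  | inr false => \sum_i x 0 i - (k%:R - 1)
  end.

Lemma affine_slack c : affine_form (slack c).
Proof.
have sumE x y z (e : R) : \sum_i (x + e *: (y - z)) 0 i =
    \sum_i x 0 i + e * (\sum_i y 0 i - \sum_i z 0 i).
  rewrite -sumrB mulr_sumr -big_split /=; apply: eq_bigr => i _.
  by rewrite !mxE.
by case: c => [[i|i]|[]] x y z e; rewrite /slack ?sumE ?mxE; ring.
Qed.

Lemma hypersimplex_slack : P = [set x | forall c, 0 <= slack c x].
Proof.
apply/seteqP; split => x /=.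
  move=> [x01 [sge sle]] [[i|i]|[]] /=; rewrite ?subr_ge0 //;
  by have /andP[] := x01 i.
move=> xc; split=> [i|].
  have := xc (inl (inl i)); have := xc (inl (inr i)).
  by rewrite /= subr_ge0 => -> ->.
by have := xc (inr true); have := xc (inr false); rewrite /= !subr_ge0.
Qed.

Definition coord_face E S top : set 'rV[R]_n :=
  [set x | P x /\ (forall i, i \notin E -> x 0 i = (i \in S)%:R) /\
           (top -> \sum_i x 0 i = k%:R)].

Definition in_rel_interior E S top z :=
  (forall i, if i \in E then is_true (0 < z 0 i < 1) else z 0 i = (i \in S)%:R) /\
  k%:R - 1 < \sum_i z 0 i /\
  (if top then \sum_i z 0 i = k%:R else \sum_i z 0 i < k%:R).

Lemma rel_interior_hhypersimplex E S top z :
  in_rel_interior E S top z -> @hhypersimplex R n k z.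
Proof.
move=> [zi [zgt ztop]]; split=> [i|].
  have := zi i; case: ifP => _; first by move=> /andP[/ltW-> /ltW->].
  by move=> ->; rewrite ler0n lern1 leq_b1.
by split=> //; case: top ztop => [->|/ltW].
Qed.

Lemma hhypersimplex_sub x : @hhypersimplex R n k x -> P x.
Proof. by move=> [x01 [/ltW xgt xle]]. Qed.

Lemma rel_interior_face E S top z :
  in_rel_interior E S top z -> coord_face E S top z.
Proof.
move=> zin; split; first exact/hhypersimplex_sub/rel_interior_hhypersimplex/zin.
have [zi [_ ztop]] := zin; split=> [i iE|tp]; last by rewrite tp in ztop.
by have := zi i; rewrite (negPf iE).
Qed.

(** The label is read off a relative interior point [z], whose tight constraints determine the
    face. *)
Lemma face_coord_face F : is_face P F -> F `&` @hhypersimplex R n k !=set0 ->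
  exists E S top, [/\ [disjoint E & S]%B, F = coord_face E S top &
    exists z, in_rel_interior E S top z].
Proof.
move=> faceF [x0 [Fx0 [_ [x0gt _]]]].
have FP x : F x -> P x by case: faceF => [a [b [_ ->]]] [].
have faceF' := faceF; rewrite hypersimplex_slack in faceF'.
have [|z Fz zF] := face_rel_interior affine_slack faceF'; first by exists x0.
have Pz := FP _ Fz; case: (Pz) => z01 [sge sle].
(* Otherwise the lower sum constraint, tight at [z], would be tight on all of [F], in particular at
   [x0]. *)
have zgt : k%:R - 1 < \sum_i z 0 i.
  rewrite lt_neqAle sge andbT; apply/eqP => zeq.
  have := zF (inr false); rewrite /= -zeq subrr => /(_ erefl _ Fx0); lra.
exists [set i | 0 < z 0 i < 1]%SET, [set i | z 0 i == 1]%SET,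
  (\sum_i z 0 i == k%:R); split.
- rewrite disjoint_subset; apply/fintype.subsetP => i; rewrite !inE => /andP[_].
  by rewrite lt_neqAle => /andP[].
- rewrite {1}(face_eq_tight affine_slack faceF' Fz zF) /coord_face hypersimplex_slack.
  apply/seteqP; split=> x /=.
    move=> [Px xz]; split=> //; split=> [i|/eqP sk]; last first.
      by have := xz (inr true); rewrite /= sk subrr => /(_ erefl); lra.
    rewrite !inE negb_and -!leNgt; have /andP[z0 z1] := z01 i.
    case: eqP => [zi _|/eqP zi1 /orP[zi|zi]].
    + by have := xz (inl (inr i)); rewrite /= zi subrr => /(_ erefl); lra.
    + by apply: (xz (inl (inl i))) => /=; apply/eqP; rewrite eq_le zi.
    + by case/negP: zi1; rewrite eq_le z1.
  move=> [Px [xz xtop]]; split=> // -[[i|i]|[]] /=.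
  + by move=> zi; rewrite xz !inE zi ?ltxx // eq_sym oner_eq0.
  + by move=> zi; rewrite xz !inE (_ : z 0 i = 1) ?ltxx ?andbF ?eqxx ?subrr //; lra.
  + by move=> zk; rewrite xtop ?subrr //; apply/eqP; lra.
  + lra.
exists z; split=> [i|].
  rewrite !inE; case: ifP => //; have /andP[z0 z1] := z01 i.
  case: eqP => [->//|/eqP zi1]; rewrite [z 0 i < 1]lt_neqAle zi1 z1 /= andbT.
  by rewrite lt_neqAle z0 andbT eq_sym => /negbFE/eqP.
by split=> //; case: eqP => // /eqP zk; rewrite lt_neqAle zk.
Qed.

(** The supporting functional has weight 0 on [E], 1 on [S] and -1 elsewhere, plus the coordinate
    sum if [top]. It falls short of [b] by [D], a sum of nonnegative defects that all vanish exactly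
    on the face. *)
Lemma coord_face_is_face E S top : is_face P (coord_face E S top).
Proof.
pose s i : R := if i \in E then 0 else if i \in S then 1 else -1.
pose d x i : R := if i \in E then 0 else if i \in S then 1 - x 0 i else x 0 i.
pose D x : R := \sum_i d x i + top%:R * (k%:R - \sum_i x 0 i).
pose b : R := \sum_(i | i \notin E) (i \in S)%:R + top%:R * k%:R.
have dot x : \sum_i (\row_i (s i + top%:R)) 0 i * x 0 i = b - D x.
  rewrite /b /D mulrBr mulr_sumr.
  transitivity (\sum_i ((if i \notin E then (i \in S)%:R else 0) - d x i
    + top%:R * x 0 i) : R).
    apply: eq_bigr => i _; rewrite mxE /s /d.
    by case: (i \in E); case: (i \in S) => /=; ring.
  by rewrite [X in X + _ - _]big_mkcond big_split sumrB /=; ring.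
have d0 x : P x -> forall i, 0 <= d x i.
  move=> [x01 _] i; rewrite /d; have /andP[x0 x1] := x01 i.
  by case: ifP => // _; case: ifP; rewrite ?subr_ge0.
have top0 x : P x -> 0 <= top%:R * (k%:R - \sum_i x 0 i).
  by move=> [_ [_ xk]]; rewrite mulr_ge0 ?subr_ge0.
exists (\row_i (s i + top%:R)), b; split=> [x Px|].
  by rewrite dot lerBlDr lerDl addr_ge0 ?sumr_ge0 ?top0 // => i _; exact: d0.
apply/seteqP; split=> x /=; rewrite dot => -[Px].
  move=> [xE xtop]; split=> //; rewrite /D big1 => [|i _].
    case: (boolP top) => [/xtop->|_]; first by rewrite subrr mulr0 addr0 subr0.
    by rewrite mul0r addr0 subr0.
  by rewrite /d; case: ifPn => // /xE ->; case: (i \in S); rewrite ?subrr.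
move=> Db; have : D x = 0 by lra.
have sd0 : 0 <= \sum_i d x i by apply: sumr_ge0 => i _; exact: d0.
move=> /eqP; rewrite paddr_eq0 ?top0 // => /andP[/eqP sd tp]; split=> //; split=> [i iE|].
  have := @psumr_eq0P _ _ _ _ (fun i _ => d0 _ Px i) sd i isT.
  by rewrite /d (negPf iE); case: (i \in S) => //= ?; lra.
by move=> top1; move: tp; rewrite top1 mul1r => /eqP; lra.
Qed.

Lemma has_dim_coord_face E S top z j : in_rel_interior E S top z ->
  has_dim (coord_face E S top) j <-> j = (#|E| - top)%N.
Proof.
move=> zin; have Fz := rel_interior_face zin.
have [zi [zgt ztop]] := zin.
have diff x y : coord_face E S top x -> coord_face E S top y ->
    (x - y <= coord_space R E top)%MS.
  move=> [_ [xE xtop]] [_ [yE ytop]]; apply/coord_spaceP; split=> [i iE|tp].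
    by rewrite !mxE xE ?yE // subrr.
  under eq_bigr do rewrite !mxE.
  by rewrite sumrB xtop ?ytop // subrr.
have step m (B : 'M[R]_(m, n)) : (B <= coord_space R E top)%MS ->
    exists2 e, 0 < e & forall i, coord_face E S top (z + e *: row i B).
  move=> BV.
  have rowB i : (forall j, j \notin E -> row i B 0 j = 0) /\
      (top -> \sum_j row i B 0 j = 0).
    exact/coord_spaceP/(submx_trans (row_sub _ _)).
  have Pz : P z by case: Fz.
  (* Indexing by pairs of a row and a constraint yields one step [e] valid for all rows. The
     constraints tight at [z] do not change along the rows, and the lower sum constraint is never
     tight. *)
  have [||e e0 He] := @small_step R ('I_m * ('I_n + 'I_n + bool))%type
    (fun ic => slack ic.2 z) (fun ic => slack ic.2 (z + row ic.1 B) - slack ic.2 z).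
  - by move=> [i c]; move: Pz; rewrite hypersimplex_slack; apply.
  - move=> [i c] /= cz; have [rE rtop] := rowB i; rewrite cz subr0.
    have fixed l : l \notin E -> (z + row i B) 0 l = z 0 l.
      by move=> lE; rewrite [LHS]mxE rE ?addr0.
    case: c cz => [[l|l]|[]] /= cz.
    + by rewrite fixed //; have := zi l; case: (l \in E) => //; rewrite cz ltxx.
    + rewrite fixed //; have := zi l; case: (l \in E) => //.
      by move=> /andP[_]; lra.
    + move: (ztop); case: ifPn => [/rtop r0 _|_]; last lra.
      under eq_bigr do rewrite [(z + _) 0 _]mxE.
      by rewrite big_split /= r0 addr0.
    + by have := zgt; lra.
  exists e => // i; have [rE rtop] := rowB i; have [_ [zE zt]] := Fz.
  split; last split=> [l lE|tp].
  - rewrite hypersimplex_slack => c; have := He (i, c).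
    by rewrite /= -affine_slack addrAC subrr add0r.
  - by rewrite mxE [X in _ + X]mxE rE // mulr0 addr0 zE.
  - under eq_bigr do rewrite [(z + _) 0 _]mxE [X in _ + X]mxE.
    by rewrite big_split /= -mulr_sumr rtop // mulr0 addr0 zt.
have dimP m := @aff_indep_rank R n m _ _ (coord_space R E top) z Fz diff (step m).
rewrite /has_dim !dimP rank_coord_space; split=> [[jE /negP]|->].
  by rewrite -ltnNge => jE'; apply/eqP; rewrite eqn_leq jE -ltnS.
by split=> //; rewrite ltnn.
Qed.

Lemma sum_rel_interior E S z : [disjoint E & S]%B ->
  (forall i, i \notin E -> z 0 i = (i \in S)%:R) ->
  \sum_i z 0 i = \sum_(i in E) z 0 i + #|S|%:R.
Proof.
move=> dES zE; rewrite (bigID (mem E)) /=; congr (_ + _).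
rewrite (eq_bigr (fun i => (i \in S)%:R)) // -natr_sum; congr (_%:R).
rewrite -sum1_card [RHS]big_mkcond [LHS]big_mkcond; apply: eq_bigr => i _ /=.
case: ifPn; rewrite ?negbK; case: (boolP (i \in S)) => // iS iE.
by have := disjointFr dES iE; rewrite iS.
Qed.

(** The sum over [E] can be anything strictly between 0 and [#|E|]; it must equal [k - #|S|] if
    [top], and lie strictly between [k - 1 - #|S|] and [k - #|S|] otherwise. *)
Lemma rel_interior_exists E S top : (0 < #|E|)%N -> [disjoint E & S]%B ->
  (exists z, in_rel_interior E S top z) <->
  (#|S| < k <= #|S| + (#|E| - top))%N.
Proof.
move=> E0 dES; split.
  move=> [z [zi [zgt ztop]]].
  have zE i : i \notin E -> z 0 i = (i \in S)%:R.
    by move=> iE; have := zi i; rewrite (negPf iE).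
  have ziE i : i \in E -> 0 < z 0 i < 1 by move=> iE; have := zi i; rewrite iE.
  have [e0 e0E] : exists i, i \in E by apply/set0Pn; rewrite -card_gt0.
  move: zgt ztop; rewrite (sum_rel_interior dES zE); set s := \sum_(i in E) _.
  have s0 : 0 < s.
    rewrite /s (bigD1 e0) //= ltr_pwDl ?sumr_ge0 //.
      by have /andP[] := ziE _ e0E.
    by move=> i /andP[/ziE/andP[/ltW]].
  have s1 : s < #|E|%:R.
    rewrite -[#|E|]sum1_card natr_sum /s (bigD1 e0) //= [ltRHS](bigD1 e0) //=.
    rewrite ltr_leD //; first by have /andP[] := ziE _ e0E.
    by apply: ler_sum => i /andP[/ziE/andP[_ /ltW]].
  move=> zgt ztop; have Sk : #|S|%:R < k%:R :> R by case: top ztop; lra.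
  rewrite -(ltr_nat R) Sk /=; case: top ztop => ztop.
    have : k%:R < (#|S| + #|E|)%:R :> R by rewrite natrD; lra.
    by rewrite ltr_nat /=; lia.
  have : k%:R < (#|S| + #|E| + 1)%:R :> R by rewrite !natrD; lra.
  by rewrite ltr_nat /=; lia.
move=> /andP[Sk kE].
(* The witness is constant on [E], with total sum [k - h]: on the upper hyperplane if [top], halfway
   between the two hyperplanes otherwise. *)
pose h : R := if top then 0 else 2^-1.
pose t : R := (k%:R - #|S|%:R - h) / #|E|%:R.
have E0' : 0 < #|E|%:R :> R by rewrite ltr0n.
have Sk1 : #|S|%:R + 1 <= k%:R :> R by rewrite natr1 ler_nat.
have kE' : k%:R + top%:R <= #|S|%:R + #|E|%:R :> R.
  rewrite -!natrD ler_nat; clear -kE E0.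
  by case: top kE; move: #|S| #|E| E0 => s e /=; lia.
have [h0 h1 h2] : [/\ 0 <= h, h <= 2^-1 & 2^-1 <= h + top%:R].
  by rewrite /h; case: (top); split=> /=; lra.
have t0 : 0 < t by rewrite divr_gt0 //; lra.
have t1 : t < 1 by rewrite ltr_pdivrMr // mul1r; lra.
pose z : 'rV[R]_n := \row_i (if i \in E then t else (i \in S)%:R).
have sumz : \sum_i z 0 i = k%:R - h.
  rewrite (@sum_rel_interior E S) // => [|i iE]; last by rewrite mxE (negPf iE).
  under eq_bigr => i iE do rewrite mxE iE.
  rewrite sumr_const -[X in X + _]mulr_natr mulfVK ?lt0r_neq0 //; lra.
exists z; split=> [i|].
  by case: ifP => iE; rewrite mxE iE ?t0 ?t1.
by rewrite sumz; split; [lra|rewrite /h; case: (top); lra].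
Qed.

Lemma coord_face_inj E S top z E' S' top' z' :
  [disjoint E & S]%B -> [disjoint E' & S']%B ->
  in_rel_interior E S top z -> in_rel_interior E' S' top' z' ->
  coord_face E S top `&` @hhypersimplex R n k =
    coord_face E' S' top' `&` @hhypersimplex R n k ->
  (E, S, top) = (E', S', top').
Proof.
(* One-sided comparison suffices: a relative interior point of the second face lies in the first, so
   it obeys the first label's equations. Exchanging the roles gives the rest. *)
suff half E1 S1 top1 z1 E2 S2 top2 z2 :
    [disjoint E2 & S2]%B ->
    in_rel_interior E1 S1 top1 z1 -> in_rel_interior E2 S2 top2 z2 ->
    coord_face E1 S1 top1 `&` @hhypersimplex R n k =
      coord_face E2 S2 top2 `&` @hhypersimplex R n k ->
    [/\ E2 \subset E1, forall i, i \notin E1 -> (i \in S1) = (i \in S2) & top1 ==> top2].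
  move=> d d' zin zin' eqF.
  have [EE' SS' tt'] := half _ _ _ _ _ _ _ _ d' zin zin' eqF.
  have [E'E _ t't] := half _ _ _ _ _ _ _ _ d zin' zin (esym eqF).
  have EE : E = E' by apply/eqP; rewrite finset.eqEsubset EE' E'E.
  subst E'; congr (_, _, _); last by case: (top) (top') tt' t't => -[].
  apply/finset.setP => i; have [iE|/SS'//] := boolP (i \in E).
  by rewrite (disjointFr d iE) (disjointFr d' iE).
move=> dES2 z1in z2in eqF.
have [_ [z2E z2top]] : coord_face E1 S1 top1 z2.
  suff: (coord_face E1 S1 top1 `&` @hhypersimplex R n k) z2 by case.
  rewrite eqF; split; first exact: rel_interior_face.
  exact: rel_interior_hhypersimplex z2in.
have [z2i [_ z2t]] := z2in.
have E21 i : i \notin E1 -> i \notin E2.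
  move=> iE1; apply/negP => iE2; have := z2i i; rewrite iE2 z2E //.
  by case: (i \in S1); rewrite ltxx ?andbF.
split.
- by apply/fintype.subsetP => i; apply: contraTT => /E21.
- move=> i iE1; have := z2i i; rewrite (negPf (E21 _ iE1)) z2E //.
  by move/eqP; rewrite eqr_nat; case: (i \in S1) (i \in S2) => -[].
- by apply/implyP => /z2top; case: top2 z2t {z2in eqF} => // /[swap] ->; rewrite ltxx.
Qed.

End HypersimplexFaces.

(** * Counting *)

Section FaceCount.
Variables (R : realType) (n k : nat).

Local Notation label := ({set 'I_n} * {set 'I_n} * bool)%type.

Definition face_index j : {set label} :=
  [set t : label | [&& #|t.1.1| == (j + t.2)%N, t.1.2 \subset ~: t.1.1 &
               #|t.1.2| < k <= #|t.1.2| + j]]%N%SET.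

Definition index_face (t : label) : set 'rV[R]_n :=
  coord_face k t.1.1 t.1.2 t.2 `&` @hhypersimplex R n k.

Lemma face_indexP j E S top : (0 < j)%N -> (E, S, top) \in face_index j <->
  [/\ j = (#|E| - top)%N, [disjoint E & S]%B &
      exists z : 'rV[R]_n, in_rel_interior k E S top z].
Proof.
move=> j0; rewrite inE /= -finset.disjoints_subset disjoint_sym; split.
  move=> /and3P[/eqP Ej dES Sk]; split=> //; first by rewrite Ej addnK.
  apply/rel_interior_exists => //; first by rewrite Ej ltn_addr.
  by rewrite Ej addnK.
(* As [j] is positive, the subtraction [#|E| - top] is not truncated. *)
move=> [jE dES]; have E0 : (0 < #|E|)%N by move: jE; case: #|E| j0 => [|//]; lia.
move=> /(rel_interior_exists R k top E0 dES) Sk; apply/and3P; split=> //.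
  by apply/eqP; rewrite jE subnK //; case: (top).
by rewrite jE.
Qed.

Lemma hfaces_image j : (0 < j)%N ->
  @hfaces R n k j = index_face @` [set` face_index j].
Proof.
move=> j0; apply/seteqP; split=> G /=.
  move=> [F [Fface [Fdim [F0 ->]]]].
  have [E [S [top [dES FE [z zin]]]]] := face_coord_face Fface F0.
  exists (E, S, top); last by rewrite /index_face FE.
  apply/face_indexP => //; split=> //; last by exists z.
  by apply/(has_dim_coord_face _ zin); rewrite -FE.
move=> [[[E S] top] /face_indexP-/(_ j0)[jE dES [z zin]] <-].
exists (coord_face k E S top); split; first exact: coord_face_is_face.
split; first exact/(has_dim_coord_face _ zin).
split=> //; exists z; split; first exact: rel_interior_face.
exact: rel_interior_hhypersimplex zin.
Qed.

Lemma fnum_face_index j : (0 < j)%N -> fnum R n k j = #|face_index j|.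
Proof.
move=> j0; rewrite /fnum hfaces_image //.
have -> : fset_set (index_face @` [set` face_index j]) =
    [fset G in [seq index_face t | t in face_index j]]%fset.
  apply/fsetP => G; rewrite in_fset_set ?inE; last exact/finite_image/finite_finset.
  apply/idP/fintype.imageP => /=; first by rewrite inE => -[t tj <-]; exists t.
  by move=> [t tj ->]; rewrite inE; exists t.
rewrite card_fseq undup_id ?size_map -?cardE //.
rewrite map_inj_in_uniq ?enum_uniq // => -[[E S] top] [[E' S'] top'].
rewrite !mem_enum.
move=> /(face_indexP _ _ _ j0)[_ dES [z zin]] /(face_indexP _ _ _ j0)[_ dES' [z' zin']].
exact: coord_face_inj zin zin'.
Qed.

(** The range condition on [k] splits into [j] equalities, the one for [i] accounting for the term
    of index [i] in [hpoly j]. *)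
Lemma sum_eq_interval (s j : nat) :
  (\sum_(i < j) (s + i.+1 == k) = (s < k <= s + j))%N.
Proof.
have [/andP[sk kj]|out] := boolP (s < k <= s + j)%N; last first.
  rewrite big1 // => i _; apply/eqP; rewrite eqb0.
  by apply: contra out => /eqP <-; have := ltn_ord i; lia.
have ij : (k - s.+1 < j)%N by lia.
rewrite (bigD1 (Ordinal ij)) //= big1 => [|i]; first by lia.
by rewrite -val_eqE /= => ki; apply/eqP; rewrite eqb0; lia.
Qed.

Lemma card_disjoint_pairs m s :
  (\sum_(E : {set 'I_n}) \sum_(S : {set 'I_n})
    [&& #|E| == m, S \subset ~: E & #|S| == s] = 'C(n, m) * 'C(n - m, s))%N.
Proof.
rewrite -[X in 'C(X, m)]card_ord -card_draws -sum1_card big_distrl /= [RHS]big_mkcond.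
apply: eq_bigr => E _; rewrite inE mul1n; case: eqP => /= [Em|_]; last by rewrite big1.
have <- : #|~: E| = (n - m)%N by rewrite cardsCs finset.setCK card_ord Em.
rewrite -cards_draws -sum1_card [RHS]big_mkcond; apply: eq_bigr => S _.
by rewrite inE; case: (_ && _).
Qed.

(** For fixed [i] the size of [S] is [k - i.+1]; the test [i < k] excludes truncation. *)
Lemma card_face_index j : #|face_index j| =
  (\sum_(i < j) \sum_(top : bool)
    if i < k then 'C(n, j + top) * 'C(n - (j + top), k - i.+1) else 0)%N.
Proof.
pose f i E S (top : bool) : nat :=
  [&& #|E : {set 'I_n}| == (j + top)%N, (S : {set 'I_n}) \subset ~: E &
      #|S| + i.+1 == k]%N.
transitivity (\sum_(t : label) \sum_(i < j) f i t.1.1 t.1.2 t.2)%N.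
  rewrite -sum1_card big_mkcond; apply: eq_bigr => -[[E S] top] _.
  rewrite inE /f /=; case: (_ == _); last by rewrite big1.
  by case: (_ \subset _) => /=; [rewrite sum_eq_interval; case: ifP|rewrite big1].
rewrite exchange_big; apply: eq_bigr => i _ /=.
rewrite -(pair_bigA _ (fun q top => f i q.1 q.2 top)) exchange_big.
apply: eq_bigr => top _; rewrite -(pair_bigA _ (fun E S => f i E S top)) /f.
case: ltnP => ik.
  rewrite -card_disjoint_pairs; apply: eq_bigr => E _; apply: eq_bigr => S _.
  by rewrite -(eqn_add2r i.+1 #|S|) subnK.
rewrite big1 // => E _; rewrite big1 // => S _.
by apply/eqP; rewrite eqb0 !negb_and; lia.
Qed.

End FaceCount.

Lemma face_gf_eq (R : realType) c :
  tseries (face_gf R) c = hpoly c * (trinom c + Y * trinom c.+1).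
Proof.
apply/funext => a; apply/funext => b.
have -> : tseries (face_gf R) c a b = #|face_index (a + b) a c|%:R.
  rewrite /tseries /face_gf; case: ifP => [/andP[/andP[_ c0] _]|guard].
    by rewrite fnum_face_index.
  (* Outside the summation range there is no label: [a = 0] or [c = 0] contradicts the bounds on
     [#|S|], and [c > a + b] leaves too few coordinates for [E]. *)
  suff -> : face_index (a + b) a c = finset.set0 by rewrite cards0.
  apply/finset.setP => -[[E S] top]; rewrite !inE /=; apply/negbTE/negP.
  move=> /and4P[/eqP Ec _ Sa aS]; have := max_card (mem E).
  rewrite card_ord Ec; move/negbT: guard; lia.
rewrite /hpoly mulr_suml ps_sum ps_sum card_face_index natr_sum.
apply: eq_bigr => i _; rewrite big_bool /= addn0 addn1.
have -> : X ^+ i.+1 * Y ^+ (c - i.+1) * (trinom c + Y * trinom c.+1) =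
    X ^+ i.+1 * Y ^+ (c.+1 - i.+1) * trinom c.+1 + X ^+ i.+1 * Y ^+ (c - i.+1) * trinom c.
  by rewrite subSn ?ltn_ord // (exprS Y); ring.
(* Here [m] is [c] or [c.+1], the number of free coordinates. The exponents left after the monomial
   add up with [m] to [a + b], so the two trinomial coefficients agree; if the power of [Y] exceeds
   [b], a binomial vanishes. *)
have coefE m : (i < m)%N ->
    ((if (i < a)%N then ('C(a + b, m) * 'C(a + b - m, a - i.+1))%N else 0%N)%:R : int) =
    (X ^+ i.+1 * Y ^+ (m - i.+1) * trinom m) a b.
  move=> im; rewrite coef_monomialM; case: ltnP => //= ia.
  case: leqP => mb; rewrite /trinom.
    by congr (('C(_, _) * 'C(_, _))%N%:R); lia.
  have [abm|mab] := ltnP (a + b) m; first by rewrite bin_small.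
  by rewrite (@bin_small (a + b - m)) ?muln0 //; lia.
by rewrite psD psD natrD !coefE // ltnS ltnW.
Qed.

(** As formal power series, face_gf = (1-x)xt / ((1-x-y)(1-x-y-xt)(1-x-y-yt)),
    stated as face_gf * denominator = numerator (the denominator has constant
    term 1, hence is invertible, so this is equivalent). *)
Theorem theorem2p1 (R : realType) : fps_mul (face_gf R) gf_den = gf_num.
Proof. exact/face_series_identity/face_gf_eq. Qed.
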